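(* Let $n \ge 1$ and let $F$ be a smooth fibration of the unit sphere $S^{2n+1} \subset \mathbb{R}^{2n+2}$ by oriented great circles, with base space $M_F \subset G_2\mathbb{R}^{2n+2}$, and let $V$ be the unit vector field on $S^{2n+1}$ tangent to the fibres and pointing in the direction of their orientation. Let $x \in S^{2n+1}$, let $P$ be the oriented 2-plane through the origin spanned by the fibre of $F$ through $x$, and let $T_x = (\nabla V)|_{V_x^{\perp}} : V_x^{\perp} = P^{\perp} \to V_x^{\perp} = P^{\perp}$, $B \mapsto \nabla_B V$, be the twisting map at $x$. Then, under the identification $T_P(G_2\mathbb{R}^{2n+2}) = \mathrm{Hom}(P, P^{\perp}) \cong P^{\perp} \oplus P^{\perp}$ given by $L \mapsto (L(x), L(V_x))$, the graph $$\{(B, T_x(B)) : B \in P^{\perp}\}$$ of $T_x$ is the tangent $2n$-plane $T_P M_F$ to $M_F$ at the point $P$; and therefore $T_x$ has no real eigenvalues.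
   Context: $S^{2n+1}$ is the unit sphere centered at the origin of $\mathbb{R}^{2n+2}$ with its round metric and Levi-Civita connection $\nabla$. A smooth fibration of $S^{2n+1}$ by oriented great circles is a smooth fibre bundle with total space $S^{2n+1}$ whose fibres are great circles (intersections of $S^{2n+1}$ with 2-dimensional linear subspaces), oriented consistently so that the unit tangent field $V$ is smooth. $G_2\mathbb{R}^{2n+2}$ denotes the Grassmann manifold of oriented 2-planes through the origin in $\mathbb{R}^{2n+2}$. Each oriented fibre of $F$ spans an oriented 2-plane $P$, viewed as a point of $G_2\mathbb{R}^{2n+2}$; the base space $M_F$ of $F$ is thereby the set of all these points, a $2n$-dimensional smooth submanifold of $G_2\mathbb{R}^{2n+2}$. For an oriented 2-plane $P$, $P^{\perp}$ is its orthogonal complement in $\mathbb{R}^{2n+2}$. A neighborhood of $P$ in $G_2\mathbb{R}^{2n+2}$ is parametrized by $\mathrm{Hom}(P,P^{\perp})$, a linear map $L : P \to P^{\perp}$ corresponding to its graph $\{v + L(v) : v \in P\}$, oriented so that orthogonal projection to $P$ preserves orientation (so $P$ corresponds to $L=0$); this identifies the tangent space $T_P(G_2\mathbb{R}^{2n+2})$ with $\mathrm{Hom}(P,P^{\perp})$. For $x \in S^{2n+1}$, $V_x$ is the value of $V$ at $x$, so that $(x, V_x)$ is an oriented orthonormal basis of the 2-plane $P$ spanned by the fibre through $x$. $V_x^{\perp}$ is the $2n$-dimensional subspace of $T_xS^{2n+1}$ orthogonal to $V_x$; parallel translation in $\mathbb{R}^{2n+2}$ to the origin identifies it with $P^{\perp}$.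 For $B \in V_x^{\perp}$, the covariant derivative $\nabla_B V$ again lies in $V_x^{\perp}$, since $\langle V, V\rangle = 1$. The linear map $T_x : V_x^{\perp} \to V_x^{\perp}$, $T_x(B) = \nabla_B V$, is called the twisting map. *)

(* Defs.v *)
From HB Require Import structures.
From mathcomp Require Import all_boot all_order all_algebra.
From mathcomp Require Import sesquilinear.
From mathcomp Require Import all_classical all_reals all_analysis.

Set Implicit Arguments.
Unset Strict Implicit.
Unset Printing Implicit Defensive.

Import Order.TTheory GRing.Theory Num.Theory.
Import numFieldNormedType.Exports.

Local Open Scope classical_set_scope.
Local Open Scope ring_scope.

Section Smooth.
Context {R : realType} {V W : normedModType R}.

(* Continuity of all iterated directional derivatives: the usual C^k in finite
   dimension, the only case used here. *)
Fixpoint is_Ck (k : nat) (U : set V) (f : V -> W) : Prop :=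
  match k with
  | 0 => forall x, U x -> {for x, continuous f}
  | k'.+1 => (forall x, U x -> differentiable f x) /\
             (forall v, is_Ck k' U (fun x => 'D_v f x))
  end.

Definition smooth_open (U : set V) (f : V -> W) : Prop :=
  forall k, is_Ck k U f.

(* Smoothness on an arbitrary subset: local smooth extendability. *)
Definition smooth_on (X : set V) (f : V -> W) : Prop :=
  forall x, X x -> exists (U : set V) (g : V -> W),
    [/\ open U, U x, smooth_open U g & forall y, X y -> U y -> f y = g y].

End Smooth.

Definition diffeo {R : realType} {V W : normedModType R}
    (X : set V) (Y : set W) (f : V -> W) : Prop :=
  exists g : W -> V,
    [/\ smooth_on X f, smooth_on Y g,
        forall x, X x -> Y (f x) /\ g (f x) = x &
        forall y, Y y -> X (g y) /\ f (g y) = y].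

Section Euclidean.
Context {R : realType} {m : nat}.
Local Notation E := 'rV[R]_m.

(* The norm carried by the library's row vectors is the sup norm, so the
   Euclidean structure is introduced separately. *)
Definition dot (u v : E) : R := \sum_i u 0 i * v 0 i.

Let dot_bilinear : bilinear_for *%R *%R dot.
Proof.
split=> u a v w /=; rewrite /dot mulr_sumr -big_split /=.
  by apply: eq_bigr => i _; rewrite !mxE mulrDl mulrA.
by apply: eq_bigr => i _; rewrite !mxE mulrDr mulrCA.
Qed.

HB.instance Definition _ :=
  bilinear_isBilinear.Build R E E R *%R *%R dot dot_bilinear.

Let dot_symmetric (u v : E) : dot u v = (-1) ^+ false * idfun (dot v u).
Proof.
by rewrite expr0 mul1r /dot; apply: eq_bigr => i _; rewrite mulrC.
Qed.

HB.instance Definition _ :=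
  isHermitianSesquilinear.Build R E false idfun dot dot_symmetric.

Definition orthogonal_complement (U : {vspace E}) : {vspace E} :=
  orthov (dot : {symmetric E}) U.

Definition unit_sphere : set E := [set x | dot x x = 1].

(* [q] is the image of [p] under a change of basis of positive determinant. *)
Definition same_orientation (p q : E * E) : Prop :=
  exists2 A : 'M[R]_2, 0 < \det A &
    q = (A 0 0 *: p.1 + A 0 1 *: p.2, A 1 0 *: p.1 + A 1 1 *: p.2).

End Euclidean.

(* A point of the Grassmannian of oriented 2-planes of R^m: a 2-dimensional
   subspace with one of its two orientation classes of ordered bases. *)
Record oriented_plane (R : realType) (m : nat) := OrientedPlane {
  plane :> {vspace 'rV[R]_m};
  positive_basis : set ('rV[R]_m * 'rV[R]_m);
  oriented_planeP : exists u v, basis_of plane [:: u; v] /\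
                      positive_basis = [set q | same_orientation (u, v) q]
}.

Section Grassmannian.
Context {R : realType} {m : nat}.
Local Notation E := 'rV[R]_m.
Implicit Type P Q : oriented_plane R m.

Definition great_circle P : set E := [set x | unit_sphere x /\ x \in plane P].

Definition HomPerp P :=
  'Hom(subvs_of (plane P), subvs_of (orthogonal_complement P)).

(* [Q] is the graph of [L], oriented so that the projection of [Q] to [P],
   whose inverse is [v |-> v + L v], preserves orientation. *)
Definition is_graph P (L : HomPerp P) Q : Prop :=
  (forall w : E, w \in plane Q <->
     exists v : subvs_of (plane P), w = vsval v + vsval (L v)) /\
  (forall u v : subvs_of (plane P), positive_basis P (vsval u, vsval v) ->
     positive_basis Q (vsval u + vsval (L u), vsval v + vsval (L v))).

(* Tangent space at [P] of a subset [M] of the Grassmannian, read in the graph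
   chart at [P]: the velocities at time 0 of the smooth curves lying in [M]
   which pass through [P] (the graph of 0) at time 0. *)
Definition tangent_space (M : set (oriented_plane R m)) P : set (HomPerp P) :=
  [set L' | exists (L : R -> HomPerp P) (e : R),
    [/\ 0 < e, L 0 = 0,
        forall v, smooth_open `]-e, e[%classic (fun t => vsval (L t v)),
        forall t, t \in `]-e, e[ -> exists2 Q, M Q & is_graph (L t) Q &
        forall v, derive1 (fun t => vsval (L t v)) 0 = vsval (L' v)]].

(* [F] is the set of fibres, each given by the oriented plane it spans.  The
   base is the quotient of the sphere by [same_fibre]; the first component of
   a local trivialization [phi], with values in the open set [O] of R^2n, is a
   chart of the base. *)
Definition same_fibre (F : set (oriented_plane R m)) (x y : E) : Prop :=
  exists P, [/\ F P, great_circle P x & great_circle P y].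

Definition locally_trivial (d : nat) (F : set (oriented_plane R m)) : Prop :=
  forall P, F P ->
  exists (U : set E) (O : set 'rV[R]_d) (phi : E -> 'rV[R]_d * 'rV[R]_2),
    let X := U `&` unit_sphere in
    [/\ open U, open O, great_circle P `<=` X,
        diffeo X (O `*` unit_sphere) phi &
        (forall x y, X x -> same_fibre F x y -> X y) /\
        (forall x y, X x -> X y -> same_fibre F x y <-> (phi x).1 = (phi y).1)].

End Grassmannian.

Arguments tangent_space {R m} M P _.

Record great_circle_fibration (R : realType) (n : nat) :=
  GreatCircleFibration {
  base : set (oriented_plane R (2 * n + 2));
  vfield : 'rV[R]_(2 * n + 2) -> 'rV[R]_(2 * n + 2);
  fibres_partition : forall x, unit_sphere x ->
    exists! P, base P /\ great_circle P x;
  fibres_locally_trivial : locally_trivial (2 * n) base;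
  vfieldP : forall P x, base P -> great_circle P x ->
    [/\ dot (vfield x) (vfield x) = 1, dot x (vfield x) = 0 &
        positive_basis P (x, vfield x)];
  vfield_smooth : smooth_on unit_sphere vfield
}.

Section Twisting.
Context {R : realType} {m : nat}.
Local Notation E := 'rV[R]_m.
Implicit Types (V : E -> E) (x B : E).

Definition radial_extension V : E -> E :=
  fun y => V ((Num.sqrt (dot y y))^-1 *: y).

(* Levi-Civita connection of the round metric: the tangential component of the
   ambient derivative of any extension of [V]. *)
Definition covariant_derivative V x B : E :=
  let W := 'D_B (radial_extension V) x in W - dot W x *: x.

Definition sphere_tangent x : {vspace E} := orthogonal_complement <[x]>.

Definition field_perp V x : {vspace E} :=
  (sphere_tangent x :&: orthogonal_complement <[V x]>)%VS.

(* [vsproj] only changes the type: see [twistingE]. *)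
Definition twisting V x : 'End(subvs_of (field_perp V x)) :=
  linfun (fun B : subvs_of (field_perp V x) =>
    vsproj (field_perp V x) (covariant_derivative V x (vsval B))).

Let differentiable_dot y : differentiable (fun z : E => dot z z) y.
Proof.
have -> : (fun z : E => dot z z) = \sum_(j < m) ((fun z : E => z 0 j) ^+ 2).
  by apply/funext => z; rewrite fct_sumE; apply: eq_bigr => j _.
by apply: differentiable_sum => j; apply: differentiableX;
   exact: differentiable_coord.
Qed.

Let differentiable_normalize y : dot y y = 1 ->
  differentiable (fun z : E => (Num.sqrt (dot z z))^-1 *: z) y.
Proof.
move=> y1.
have d : differentiable (fun z : E => (Num.sqrt (dot z z))^-1) y.
  apply: differentiableV; last by rewrite y1 sqrtr1 oner_eq0.
  apply: (@differentiable_comp _ _ _ _ (fun z : E => dot z z) Num.sqrt) => //.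
  apply/derivable1_diffP; rewrite y1.
  by case: (@is_derive1_sqrt R 1 ltr01).
have -> : (fun z : E => (Num.sqrt (dot z z))^-1 *: z) =
  \sum_(j < m) (fun z : E =>
     ((Num.sqrt (dot z z))^-1 * z 0 j) *: (delta_mx 0 j : E)).
  apply/funext => z; rewrite fct_sumE [X in _ *: X = _]row_sum_delta scaler_sumr.
  by apply: eq_bigr => j _; rewrite scalerA.
apply: differentiable_sum => j; apply: differentiableZl.
exact: (differentiableM d (differentiable_coord _ _ _)).
Qed.

Let radial_near V x : smooth_on unit_sphere V -> unit_sphere x ->
  exists2 g : E -> E, differentiable g x &
    \forall y \near x, radial_extension V y = g y /\
                       unit_sphere ((Num.sqrt (dot y y))^-1 *: y).
Proof.
move=> sV x1; have [U [g [oU Ux sg gE]]] := sV x x1.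
pose N := fun z : E => (Num.sqrt (dot z z))^-1 *: z.
have Nx : N x = x by rewrite /N x1 sqrtr1 invr1 scale1r.
have dN : differentiable N x by exact: differentiable_normalize.
exists (g \o N).
  by apply: differentiable_comp => //; rewrite Nx; case: (sg 1%N) => + _; apply.
have p : \forall y \near x, 0 < dot y y.
  have /(_ [set r | 0 < r]) := differentiable_continuous (differentiable_dot x).
  apply.
  by rewrite x1; exact: lt_nbhsr ltr01.
have q : \forall y \near x, U (N y).
  have /(_ U) := differentiable_continuous dN; apply; rewrite Nx.
  exact: open_nbhs_nbhs.
near=> y.
have y0 : 0 < dot y y by near: y.
have Ny : unit_sphere (N y).
  rewrite /unit_sphere /= /N linearZl_LR linearZr_LR /=.
  rewrite mulrA -invfM -expr2 sqr_sqrtr ?ltW// mulVf// gt_eqF//.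
split=> //; apply: gE => //; near: y; exact: q.
Unshelve. all: by end_near. Qed.

Lemma covariant_derivative_linear V x : smooth_on unit_sphere V -> unit_sphere x ->
  linear (covariant_derivative V x).
Proof.
move=> sV x1; have [g gd Vg] := radial_near sV x1.
have DE B : 'D_B (radial_extension V) x = 'd g x B.
  rewrite -deriveE//; apply: near_eq_derive.
  by apply: filterS Vg => y [].
move=> a u v; rewrite /covariant_derivative !DE linearP linearPl.
by rewrite scalerDl scalerBr scalerA opprD addrACA.
Qed.

Lemma covariant_derivative_perp V x B : smooth_on unit_sphere V ->
  (forall y, unit_sphere y -> dot (V y) (V y) = 1) ->
  unit_sphere x -> dot x (V x) = 0 ->
  covariant_derivative V x B \in field_perp V x.
Proof.
move=> sV V1 x1 xV; have [g gd Vg] := radial_near sV x1.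
have DE : 'D_B (radial_extension V) x = 'D_B g x.
  by apply: near_eq_derive; apply: filterS Vg => y [].
have gx : g x = V x.
  have [<- _] := nbhs_singleton Vg.
  by rewrite /radial_extension x1 sqrtr1 invr1 scale1r.
have gder : derivable g x B by exact: diff_derivable.
have cder j : derivable (fun y => g y 0 j) x B.
    exact: ((derivable_mxP g x B).1 gder 0 j).
have gg : dot ('D_B g x) (g x) = 0.
  have : 'D_B (\sum_(j < m) ((fun y => g y 0 j) * (fun y => g y 0 j))) x = 0.
    rewrite -[RHS](derive_cst (1 : R) x B); apply: near_eq_derive.
    apply: filterS Vg => y [yg yS]; rewrite fct_sumE /cst -(V1 _ yS).
    by rewrite -/(radial_extension V y) yg.
  rewrite derive_sum; last by move=> j; exact: derivableM.
  under eq_bigr do rewrite deriveM// -mulr2n.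
  rewrite sumrMnl => /eqP; rewrite mulrn_eq0/= => /eqP; apply: etrans.
  rewrite derive_mx//; apply: eq_bigr => j _.
  by rewrite mxE mulrC.
rewrite /covariant_derivative DE memv_cap; apply/andP; split.
  by rewrite mem_orthov1 linearBl/= linearZl_LR/= x1 mulr1 subrr.
by rewrite mem_orthov1 linearBl/= linearZl_LR/= xV mulr0 subr0 -gx gg.
Qed.

Lemma twistingE V x (B : subvs_of (field_perp V x)) : smooth_on unit_sphere V ->
  (forall y, unit_sphere y -> dot (V y) (V y) = 1) ->
  unit_sphere x -> dot x (V x) = 0 ->
  vsval (twisting V x B) = covariant_derivative V x (vsval B).
Proof.
move=> sV V1 x1 xV; rewrite /twisting.
pose f (B : subvs_of (field_perp V x)) :=
  vsproj (field_perp V x) (covariant_derivative V x (vsval B)).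
have fl : linear f.
  move=> a u v; rewrite /f [vsval _]linearP covariant_derivative_linear//.
  by rewrite linearP.
pose fL : {linear _ -> _} := HB.pack f (GRing.isLinear.Build _ _ _ _ _ fl).
rewrite (_ : linfun _ = linfun fL) // lfunE /= /f vsprojK//.
exact: covariant_derivative_perp.
Qed.

End Twisting.

(* Main.v *)
From HB Require Import structures.
Require Import Defs.
From mathcomp Require Import all_boot all_order all_algebra.
From mathcomp Require Import sesquilinear.
From mathcomp Require Import all_classical all_reals all_analysis.
From mathcomp Require Import ring.

(** The tangent plane to the base at P is computed by moving along curves of
    the base and looking at how the fibres turn.  Near P a fibre is the graph of
    some L : P -> P^perp.  If it passes through the direction of x + L x, then
    it contains the vector w = V((x + L x) / |x + L x|), and being in the graph
    means
      w = a x + b V_x + a L(x) + b L(V_x),  a = <w, x>, b = <w, V_x>.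
    At L = 0 one has a = 0 and b = 1, so differentiating the component of this
    equality in P^perp gives T_x(L'(x)) = L'(V_x) for the velocity L' of any
    curve of the base through P: this is [tangent_covariant_derivative], one of
    the two inclusions.

    Conversely, for B in P^perp the fibres through the points (x + tB)/|x + tB|
    are, for small t, graphs of maps L_t, and the equality above determines
    them: L_t(x) = tB and L_t(V_x) = (w_perp - a t B) / b.  They form a smooth
    curve because V is smooth, and its velocity sends x to B
    ([exists_tangent]); together with the first inclusion this exhibits (B, T_x B)
    as a tangent vector.

    For the absence of real eigenvalues, the equality
    T_z(L'(z)) = L'(V_z) holds at every point z of the fibre with the same L'.
    If T_x B = a B, take L' tangent with L'(x) = B; then L' vanishes at
    V_x - a x, hence at the point z of the great circle in that direction, hence
    also at V_z by linearity of T_z.  As z and V_z span P, L' = 0 and B = 0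
    ([covariant_derivative_eigen]).

    The analytic input is a small calculus of C^k maps (sums, products,
    inverses, compositions), from which the degree-0 homogeneous extension of a
    smooth field on the sphere is smooth near the sphere
    ([smooth_radial_extension]). *)

Set Implicit Arguments.
Unset Strict Implicit.
Unset Printing Implicit Defensive.

Import Order.TTheory GRing.Theory Num.Theory.
Import numFieldNormedType.Exports.

Local Open Scope classical_set_scope.
Local Open Scope ring_scope.

(** * Calculus of C^k maps *)

Section CkCalculus.
Context {R : realType} {V : normedModType R}.
Implicit Types (U : set V) (k : nat).

Lemma is_CkW (W : normedModType R) k U (f : V -> W) :
  is_Ck k.+1 U f -> is_Ck k U f.
Proof.
elim: k f => [|k IH] f [fd fD].
  by move=> x Ux; exact/differentiable_continuous/fd.
by split=> // v; exact/IH/fD.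
Qed.

Lemma is_Ck_sub (W : normedModType R) k U U' (f : V -> W) :
  U' `<=` U -> is_Ck k U f -> is_Ck k U' f.
Proof.
move=> sU; elim: k f => [|k IH] f; first by move=> fc x /sU; exact: fc.
by move=> [fd fD]; split=> [x /sU /fd//|v]; exact/IH/fD.
Qed.

(** Differentials are defined by choice, so equality near the point does not
    transfer differentiability by rewriting: the first-order expansion is what
    transfers, and it determines the differential. *)
Lemma near_eq_differentiable (W : normedModType R) (f g : V -> W) x :
  (\forall y \near x, f y = g y) -> differentiable f x -> differentiable g x.
Proof.
move=> fg df; have gx : f x = g x := nbhs_singleton fg.
have dE : g \o shift x = cst (g x) + 'd f x +o_ 0 id.
  apply/eqaddoP => e e0.
  have /eqaddoP/(_ e e0) := diff_locally df.
  have shift_fg : \forall h \near (0 : V), f (h + x) = g (h + x).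
    by move: fg; rewrite (near_shift 0 x); apply: filterS => h /=; rewrite subr0.
  by apply: filterS2 shift_fg => h; rewrite !fctE /= -gx => ->.
have dg : 'd g x = 'd f x :> (V -> W) by apply: diff_unique dE; exact: diff_continuous.
by apply/diff_locallyP; rewrite dg; split=> //; exact: diff_continuous.
Qed.

Lemma eq_is_Ck (W : normedModType R) k U (f g : V -> W) :
  open U -> (forall x, U x -> f x = g x) -> is_Ck k U f -> is_Ck k U g.
Proof.
move=> oU; elim: k f g => [|k IH] f g fg.
  move=> fc x Ux; have near_fg : \forall y \near x, f y = g y.
    by apply: filterS (open_nbhs_nbhs (conj oU Ux)) => y; exact: fg.
  have := fc x Ux; rewrite /prop_for /continuous_at -fg//.
  exact: cvg_trans (near_eq_cvg near_fg).
move=> [fd fD].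
have near_fg x : U x -> \forall y \near x, f y = g y.
  by move=> Ux; apply: filterS (open_nbhs_nbhs (conj oU Ux)) => y; exact: fg.
split=> [x Ux|v]; first exact: near_eq_differentiable (near_fg x Ux) (fd x Ux).
apply: IH (fD v) => x Ux; apply: near_eq_derive; exact: near_fg.
Qed.

Lemma is_Ck_cst (W : normedModType R) k U (c : W) : is_Ck k U (cst c).
Proof.
elim: k c => [|k IH] c; first by move=> x _; exact: cvg_cst.
split=> [x _|v]; first exact: differentiable_cst.
by under eq_fun do rewrite derive_cst; exact: IH.
Qed.

Lemma is_Ck_id k U : is_Ck k U id.
Proof.
case: k => [|k]; first by move=> x _; exact: cvg_id.
split=> // v; under eq_fun do rewrite derive_id; exact: is_Ck_cst.
Qed.

Lemma is_CkD (W : normedModType R) k U (f g : V -> W) : open U ->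
  is_Ck k U f -> is_Ck k U g -> is_Ck k U (f \+ g).
Proof.
move=> oU; elim: k f g => [|k IH] f g.
  by move=> fc gc x Ux; exact: (cvgD (fc x Ux) (gc x Ux)).
move=> [fd fD] [gd gD]; split=> [x Ux|v].
  exact: differentiableD (fd x Ux) (gd x Ux).
apply: (eq_is_Ck oU) (IH _ _ (fD v) (gD v)) => x Ux.
by rewrite [RHS]deriveD//; apply: diff_derivable; [exact: fd|exact: gd].
Qed.

Lemma is_CkM k U (f g : V -> R) : open U ->
  is_Ck k U f -> is_Ck k U g -> is_Ck k U (f \* g).
Proof.
move=> oU; elim: k f g => [|k IH] f g.
  by move=> fc gc x Ux; exact: (cvgM (fc x Ux) (gc x Ux)).
move=> fk gk; have [fd fD] := fk; have [gd gD] := gk; split=> [x Ux|v].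
  exact: differentiableM (fd x Ux) (gd x Ux).
have := is_CkD oU (IH _ _ (is_CkW fk) (gD v)) (IH _ _ (is_CkW gk) (fD v)).
apply: (eq_is_Ck oU) => x Ux.
by rewrite [RHS]deriveM//; apply: diff_derivable; [exact: fd|exact: gd].
Qed.

Lemma is_Ck_sum k U (I : Type) (r : seq I) (f : I -> V -> R) : open U ->
  (forall i, is_Ck k U (f i)) -> is_Ck k U (fun x => \sum_(i <- r) f i x).
Proof.
move=> oU fk; elim: r => [|i r IH].
  by under eq_fun do rewrite big_nil; exact: is_Ck_cst.
by under eq_fun do rewrite big_cons; exact: is_CkD (fk i) IH.
Qed.

(** A map whose derivatives are built smoothly from the map itself gains one
    degree of smoothness at a time.  This covers both the inverse, with
    D(1/f) = - Df (1/f)^2, and 1/|y|, with D_v(1/|y|) = - <v, y> (1/|y|)^3. *)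
Lemma is_Ck_bootstrap U (W : normedModType R) (f : V -> W) (G : V -> V -> W) :
  open U -> (forall x, U x -> differentiable f x) ->
  (forall v x, U x -> 'D_v f x = G v x) ->
  (forall k v, is_Ck k U f -> is_Ck k U (G v)) ->
  smooth_open U f.
Proof.
move=> oU fd fG GC; elim=> [|k IH].
  by move=> x Ux; exact/differentiable_continuous/fd.
split=> // v; apply: eq_is_Ck (GC k v IH) => // x Ux.
by rewrite fG.
Qed.

Lemma smooth_inv U (f : V -> R) : open U -> (forall x, U x -> f x != 0) ->
  smooth_open U f -> smooth_open U (fun x => (f x)^-1).
Proof.
move=> oU f0 fs.
have fd x : U x -> differentiable f x by have [+ _] := fs 1%N; apply.
apply: (@is_Ck_bootstrap _ _ _
  (fun v x => - 1 * ('D_v f x * ((f x)^-1 * (f x)^-1)))) => //.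
- by move=> x Ux; apply: differentiableV; [exact: fd|exact: f0].
- move=> v x Ux; rewrite [LHS]deriveV ?f0//; last exact/diff_derivable/fd.
  by rewrite /GRing.scale/= mulN1r mulNr -expr2 exprVn mulrC.
move=> k v fk; apply: (is_CkM oU); first exact: is_Ck_cst.
apply: (is_CkM oU); first by have [_] := fs k.+1; exact.
exact: is_CkM.
Qed.

(** Products are taken between real-valued maps; vector-valued maps are reduced to
    these through their coordinates. *)
Section Coordinates.
Context {m : nat}.

Lemma coord_sum (f : V -> 'rV[R]_m) :
  f = \sum_(j < m) (fun x => f x 0 j *: (delta_mx 0 j : 'rV[R]_m)).
Proof.
by apply/funext => x; rewrite fct_sumE [LHS]row_sum_delta.
Qed.

Lemma differentiable_rowP (f : V -> 'rV[R]_m) x :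
  (forall j, differentiable (fun y => f y 0 j) x) -> differentiable f x.
Proof.
move=> fd; rewrite (coord_sum f); apply: differentiable_sum => j.
exact/differentiableZl/fd.
Qed.

Lemma derive_coord (f : V -> 'rV[R]_m) x v j : derivable f x v ->
  'D_v (fun y => f y 0 j) x = 'D_v f x 0 j.
Proof. by move=> fd; rewrite derive_mx// mxE. Qed.

Lemma derivable_coord (f : V -> 'rV[R]_m) x v j : derivable f x v ->
  derivable (fun y => f y 0 j) x v.
Proof. by move=> /derivable_mxP/(_ 0 j). Qed.

Lemma is_Ck_row k U (f : V -> 'rV[R]_m) : open U ->
  (forall j, is_Ck k U (fun x => f x 0 j)) <-> is_Ck k U f.
Proof.
move=> oU; elim: k f => [|k IH] f.
  split=> fc.
    move=> x Ux; rewrite /prop_for /continuous_at.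
    rewrite [X in _ --> X]row_sum_delta; under eq_cvg do rewrite [f _]row_sum_delta.
    apply: (@cvg_big _ _ _ _ _ add_continuous _ _ _
      (fun j y => f y 0 j *: (delta_mx 0 j : 'rV[R]_m))) => j _.
    by apply: cvgZr_tmp; exact: fc.
  move=> j x Ux; apply: (@continuous_comp _ _ _ f (fun M : 'rV[R]_m => M 0 j)).
    exact: fc.
  exact/differentiable_continuous/differentiable_coord.
split=> [fj|[fd fD] j].
  have fd x : U x -> differentiable f x.
    by move=> Ux; apply: differentiable_rowP => j; case: (fj j) => + _; apply.
  split=> // v; apply/IH => j; case: (fj j) => _ /(_ v).
  apply: eq_is_Ck => // x Ux; rewrite derive_coord//.
  exact/diff_derivable/fd.
split=> [x Ux|v].
  apply: (@differentiable_comp _ _ _ _ f (fun M : 'rV[R]_m => M 0 j)).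
    exact: fd.
  exact: differentiable_coord.
have /IH/(_ j) := fD v.
apply: eq_is_Ck => // x Ux; rewrite derive_coord//.
exact/diff_derivable/fd.
Qed.

Lemma is_Ck_dot k U (f g : V -> 'rV[R]_m) : open U ->
  is_Ck k U f -> is_Ck k U g -> is_Ck k U (fun x => dot (f x) (g x)).
Proof.
move=> oU /(is_Ck_row _ _ oU) fk /(is_Ck_row _ _ oU) gk.
by apply: is_Ck_sum => // i; exact: is_CkM.
Qed.

Lemma is_CkZ k U (a : V -> R) (f : V -> 'rV[R]_m) : open U ->
  is_Ck k U a -> is_Ck k U f -> is_Ck k U (fun x => a x *: f x).
Proof.
move=> oU ak /(is_Ck_row _ _ oU) fk; apply/(is_Ck_row _ _ oU) => j.
by under eq_fun do rewrite mxE; exact: is_CkM.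
Qed.

(** By the chain rule the derivatives of the composite are sums of products of
    the coordinates of the derivative of [c] and of composites of partial
    derivatives of [f] with [c], to which the induction applies; hence the
    induction is on [k] with [f] varying. *)
Lemma is_Ck_comp k U (U' : set 'rV[R]_m) (f : 'rV[R]_m -> R) (c : V -> 'rV[R]_m) :
  open U -> (forall x, U x -> U' (c x)) -> is_Ck k U' f -> is_Ck k U c ->
  is_Ck k U (f \o c).
Proof.
move=> oU cU; elim: k f => [|k IH] f.
  move=> fc cc x Ux; apply: continuous_comp; first exact: cc.
  exact/fc/cU.
move=> [fd fD] ck; have [cd cD] := ck; split=> [x Ux|v].
  by apply: differentiable_comp; [exact: cd|exact/fd/cU].
pose h x := \sum_(j < m) 'D_v c x 0 j * 'D_(delta_mx 0 j) f (c x).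
apply: (@eq_is_Ck _ _ _ h) => // [x Ux|].
  have dc := cd x Ux; have df := fd (c x) (cU x Ux).
  apply/esym; rewrite deriveE; last exact: differentiable_comp.
  rewrite diff_comp//= -(deriveE _ dc) [in LHS](row_sum_delta ('D_v c x)).
  rewrite linear_sum; apply: eq_bigr => j _.
  by rewrite linearZ -deriveE.
apply: is_Ck_sum => // j; apply: (is_CkM oU).
  by have /(is_Ck_row _ _ oU)/(_ j) := cD v.
exact: (IH _ (fD _) (is_CkW ck)).
Qed.

End Coordinates.
End CkCalculus.

(** * Inner product and normalization *)

Section InnerProduct.
Context {R : realType} {V : normedModType R} {m : nat}.

Lemma dotDl (u v w : 'rV[R]_m) : dot (u + v) w = dot u w + dot v w.
Proof. exact: linearDl. Qed.

Lemma dotDr (u v w : 'rV[R]_m) : dot w (u + v) = dot w u + dot w v.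
Proof. exact: linearDr. Qed.

Lemma dotZl a (u w : 'rV[R]_m) : dot (a *: u) w = a * dot u w.
Proof. exact: linearZl_LR. Qed.

Lemma dotZr a (u w : 'rV[R]_m) : dot w (a *: u) = a * dot w u.
Proof. exact: linearZr_LR. Qed.

Lemma dotC (u v : 'rV[R]_m) : dot u v = dot v u.
Proof. by apply: eq_bigr => i _; rewrite mulrC. Qed.

Lemma dotr0 (u : 'rV[R]_m) : dot u 0 = 0.
Proof. exact: linear0r. Qed.

Lemma dot_gt0 (u : 'rV[R]_m) : u != 0 -> 0 < dot u u.
Proof.
move=> u0; have sq_ge0 i : true -> 0 <= u 0 i * u 0 i by rewrite -expr2 sqr_ge0.
rewrite lt_neqAle sumr_ge0// andbT eq_sym; apply: contraNneq u0 => uu.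
apply/eqP/rowP => i; rewrite mxE; apply/eqP; rewrite -[_ == _]orbb -mulf_eq0.
by apply/eqP; apply: (psumr_eq0P sq_ge0 uu).
Qed.

Lemma is_derive_dot (f g : V -> 'rV[R]_m) x v (df dg : 'rV[R]_m) :
  is_derive x v f df -> is_derive x v g dg ->
  is_derive x v (fun y => dot (f y) (g y)) (dot df (g x) + dot (f x) dg).
Proof.
move=> [fd <-] [gd <-].
have fj j : derivable (fun y => f y 0 j) x v by exact: derivable_coord fd.
have gj j : derivable (fun y => g y 0 j) x v by exact: derivable_coord gd.
have -> : (fun y => dot (f y) (g y)) =
    \sum_(j < m) ((fun y => f y 0 j) * (fun y => g y 0 j)).
  by apply/funext => y; rewrite fct_sumE.
have fgj j : derivable ((fun y => f y 0 j) * (fun y => g y 0 j)) x v.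
  exact: derivableM.
split; first exact: derivable_sum.
rewrite (derive_sum fgj) addrC -big_split /=; apply: eq_bigr => j _.
rewrite (deriveM (fj j) (gj j)) (derive_coord _ fd) (derive_coord _ gd).
by congr (_ + _); exact: mulrC.
Qed.

Lemma is_derive_scale (a : V -> R) (f : V -> 'rV[R]_m) x v (da : R) (df : 'rV[R]_m) :
  is_derive x v a da -> is_derive x v f df ->
  is_derive x v (fun y => a y *: f y) (da *: f x + a x *: df).
Proof.
move=> [ad <-] [fd <-]; have fj j : derivable (fun y => f y 0 j) x v by exact: derivable_coord fd.
have coordE j : (fun y => (a y *: f y) 0 j) = a * (fun y => f y 0 j).
  by apply/funext => y; rewrite mxE.
have pd : derivable (fun y => a y *: f y) x v.
  apply/derivable_mxP => i j; rewrite (ord1 i) coordE.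
  exact: derivableM ad (fj j).
split; first exact: pd.
apply/rowP => j; rewrite -(derive_coord _ pd) coordE (deriveM ad (fj j)).
rewrite (derive_coord _ fd) addrC [RHS]mxE; congr (_ + _); rewrite mxE//.
exact: mulrC.
Qed.

End InnerProduct.

Lemma is_derive_comp_row (R : realType) (W : normedModType R) (m : nat)
    (f : 'rV[R]_m -> W) (c : R -> 'rV[R]_m) (t : R) (dc : 'rV[R]_m) :
  is_derive t 1 c dc -> differentiable f (c t) ->
  is_derive t 1 (f \o c) ('D_dc f (c t)).
Proof.
move=> [cd <-] fd; have cd' : differentiable c t by apply/derivable1_diffP.
have fcd : differentiable (f \o c) t by exact: differentiable_comp.
split; first exact: diff_derivable.
by rewrite (deriveE _ fcd) diff_comp//= -(deriveE _ cd') -(deriveE _ fd).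
Qed.

Section Radial.
Context {R : realType} {m : nat}.
Local Notation E := 'rV[R]_m.

Definition inv_norm (y : E) : R := (Num.sqrt (dot y y))^-1.

Lemma smooth_sqnorm : smooth_open setT (fun y : E => dot y y).
Proof. by move=> k; apply: is_Ck_dot (@is_Ck_id _ _ _ _) (@is_Ck_id _ _ _ _); exact: openT. Qed.

Lemma open_sqnorm_gt0 : open [set y : E | 0 < dot y y].
Proof.
apply: (@open_comp _ _ (fun y : E => dot y y) [set r | 0 < r]) => [y _|].
  exact: (smooth_sqnorm 0%N).
exact: open_gt.
Qed.

Lemma smooth_inv_norm : smooth_open [set y : E | 0 < dot y y] inv_norm.
Proof.
have dd (y : E) : differentiable (fun z : E => dot z z) y.
  by have [+ _] := smooth_sqnorm 1%N; exact.
have oD := open_sqnorm_gt0.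
have ds (r : R) : 0 < r -> differentiable Num.sqrt r.
  by move=> r0; apply/derivable1_diffP; case: (is_derive1_sqrt r0).
have dsd (y : E) : 0 < dot y y -> differentiable (Num.sqrt \o (fun z : E => dot z z)) y.
  by move=> y0; apply: differentiable_comp => //; exact: ds.
have s0 (y : E) : 0 < dot y y -> Num.sqrt (dot y y) != 0.
  by move=> y0; rewrite gt_eqF// sqrtr_gt0.
apply: (@is_Ck_bootstrap _ _ _ _ _
   (fun v y => - 1 * (dot v y * (inv_norm y * (inv_norm y * inv_norm y))))) => //.
- by move=> y y0; apply: differentiableV; [exact: dsd|exact: s0].
- move=> v y y0; rewrite [LHS]deriveV; [|exact: s0|exact/diff_derivable/dsd].
  have [_ dotE] := is_derive_dot (is_derive_id y v) (is_derive_id y v).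
  have ds' := ds _ y0.
  rewrite deriveE; last exact: dsd.
  rewrite diff_comp//= -[X in 'd _ _ X](deriveE _ (dd y)) dotE diff1E; last exact: ds.
  rewrite derive1E; have [_ ->] := is_derive1_sqrt y0.
  rewrite (dotC y v) /GRing.scale /= /inv_norm -mulr2n -(mulr_natl (dot v y)).
  by move: (s0 y y0) => sy0; field.
move=> k v nk; apply: is_CkM => //; first exact: is_Ck_cst.
apply: is_CkM => //; first by apply: is_Ck_dot => //; [exact: is_Ck_cst|exact: is_Ck_id].
by do 2 apply: is_CkM => //.
Qed.

Definition normalize (y : E) : E := inv_norm y *: y.

Lemma unit_normalize y : 0 < dot y y -> unit_sphere (normalize y).
Proof.
move=> y0; rewrite /unit_sphere /= dotZl dotZr mulrA -expr2 exprVn.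
by rewrite sqr_sqrtr ?ltW// mulVf// gt_eqF.
Qed.

Lemma normalize_id x : unit_sphere x -> normalize x = x.
Proof. by rewrite /normalize /inv_norm => ->; rewrite sqrtr1 invr1 scale1r. Qed.

Lemma radial_extension_id (V : E -> E) x : unit_sphere x -> radial_extension V x = V x.
Proof. by move=> x1; rewrite /radial_extension -/(normalize x) normalize_id. Qed.

(** Composing the local smooth extension that the smoothness of [V] provides with
    the normalization, which is smooth off the origin. *)
Lemma smooth_radial_extension (V : E -> E) x :
  smooth_on unit_sphere V -> unit_sphere x ->
  exists U, [/\ open U, U x, smooth_open U (radial_extension V) &
                forall y, U y -> 0 < dot y y].
Proof.
move=> sV x1; have [U [g [oU Ux sg gE]]] := sV x x1.
pose D := [set y : E | 0 < dot y y].
have oD : open D := open_sqnorm_gt0.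
have sN : smooth_open D normalize.
  by move=> k; apply: is_CkZ => //; [exact: smooth_inv_norm|exact: is_Ck_id].
pose A := D `&` normalize @^-1` U.
have oA : open A.
  rewrite openE => y [Dy Uy]; apply: filterI; first exact: open_nbhs_nbhs.
  by apply: (sN 0%N y Dy); exact: open_nbhs_nbhs.
exists A; split=> //.
- split; first by rewrite /D /= x1 ltr01.
  by rewrite /preimage /= normalize_id.
- move=> k; apply: (@eq_is_Ck _ _ _ _ _ (g \o normalize)) => //.
    by move=> y [Dy Uy]; rewrite /= -gE//; exact: unit_normalize.
  apply/is_Ck_row => // j; apply: (@is_Ck_comp _ _ _ _ _ U (fun y => g y 0 j)) => //.
  + by move=> y [].
  + by have /(is_Ck_row _ _ oU)/(_ j) := sg k.
  + by apply: is_Ck_sub (sN k) => y [].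
- by move=> y [].
Qed.

End Radial.

(** * Oriented planes and graphs *)

Lemma det_mx22 (K : comRingType) (A : 'M[K]_2) :
  \det A = A 0 0 * A 1 1 - A 0 1 * A 1 0.
Proof.
rewrite (expand_det_row _ 0) !big_ord_recl big_ord0 addr0 /cofactor.
rewrite !det_mx11 !mxE /= expr0 expr1 mul1r mulN1r mulrN.
by congr (A _ _ * A _ _ - A _ _ * A _ _); apply: val_inj.
Qed.

Lemma vsval_comb (K : fieldType) (vT : vectType K) (U : {vspace vT}) (a b : K)
  (u v : subvs_of U) : vsval (a *: u + b *: v) = a *: vsval u + b *: vsval v.
Proof. by rewrite linearP linearZ. Qed.

Section OrientedPlanes.
Context {R : realType} {m : nat}.
Local Notation E := 'rV[R]_m.
Implicit Types (P Q : oriented_plane R m) (u v w y : E).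

Lemma same_orientationP (p q : E * E) : same_orientation p q <->
  exists a b c d : R, 0 < a * d - b * c /\
    q = (a *: p.1 + b *: p.2, c *: p.1 + d *: p.2).
Proof.
split=> [[A dA ->]|[a [b [c [d [dp ->]]]]]].
  exists (A 0 0), (A 0 1), (A 1 0), (A 1 1); split=> //.
  by rewrite -det_mx22.
pose A : 'M[R]_2 := \matrix_(i, j) if i == 0 then (if j == 0 then a else b)
  else (if j == 0 then c else d).
by exists A; rewrite ?det_mx22 !mxE.
Qed.

Lemma same_orientation_sym (p q : E * E) :
  same_orientation p q -> same_orientation q p.
Proof.
case: p => p1 p2; move/same_orientationP => [a [b [c [d [dp ->]]]]] /=.
set D := a * d - b * c in dp; have D0 : D != 0 by rewrite gt_eqF.
apply/same_orientationP; exists (d / D), (- b / D), (- c / D), (a / D); split.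
  have -> : d / D * (a / D) - - b / D * (- c / D) = D^-1 by rewrite /D; field.
  by rewrite invr_gt0.
by congr pair; apply/rowP => i; rewrite !mxE /D; field.
Qed.

Lemma same_orientation_trans (q p r : E * E) :
  same_orientation p q -> same_orientation q r -> same_orientation p r.
Proof.
case: p => p1 p2; move=> /same_orientationP [a [b [c [d [dp ->]]]]] /=.
move=> /same_orientationP [a' [b' [c' [d' [dp' ->]]]]] /=.
apply/same_orientationP => /=.
exists (a' * a + b' * c), (a' * b + b' * d), (c' * a + d' * c), (c' * b + d' * d).
split; last by congr pair; apply/rowP => i; rewrite !mxE; ring.
have -> : (a' * a + b' * c) * (c' * b + d' * d) -
  (a' * b + b' * d) * (c' * a + d' * c) = (a' * d' - b' * c') * (a * d - b * c) by ring.
exact: mulr_gt0.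
Qed.

Lemma positive_basisE P p q : positive_basis P p ->
  positive_basis P q <-> same_orientation p q.
Proof.
have [u [v [_ ->]]] := oriented_planeP P => /= up; split=> [uq|].
  exact: same_orientation_trans (same_orientation_sym up) uq.
exact: same_orientation_trans.
Qed.

Lemma mem_plane P u v w : positive_basis P (u, v) ->
  w \in plane P <-> exists a b, w = a *: u + b *: v.
Proof.
have [u0 [v0 [/span_basis <- ->]]] := oriented_planeP P.
have memE z : z \in <<[:: u0; v0]>>%VS <-> exists a b, z = a *: u0 + b *: v0.
  rewrite span_cons span_seq1; split.
    by move=> /memv_addP [_ /vlineP[a ->] [_ /vlineP[b ->] ->]]; exists a, b.
  move=> [a [b ->]]; apply/memv_addP.
  by exists (a *: u0); [|exists (b *: v0)]; rewrite ?memvZ ?memv_line.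
move=> /= uv; rewrite memE.
have half (p q : E * E) : same_orientation p q ->
    forall a b, exists a' b', a *: q.1 + b *: q.2 = a' *: p.1 + b' *: p.2.
  move=> /same_orientationP [a [b [c [d [_ ->]]]]] s t /=.
  exists (s * a + t * c), (s * b + t * d).
  by apply/rowP => i; rewrite !mxE; ring.
split=> [[a [b ->]]|[a [b ->]]].
  exact: half (same_orientation_sym uv) a b.
exact: half uv a b.
Qed.

Lemma positive_basis_mem P u v : positive_basis P (u, v) ->
  u \in plane P /\ v \in plane P.
Proof.
move=> uv; split; apply/(mem_plane _ uv).
  by exists 1, 0; rewrite scale1r scale0r addr0.
by exists 0, 1; rewrite scale1r scale0r add0r.
Qed.

Lemma mem_orthogonal_complement P u v w : positive_basis P (u, v) ->
  (w \in orthogonal_complement (plane P)) = (dot w u == 0) && (dot w v == 0).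
Proof.
move=> uv; have [uP vP] := positive_basis_mem uv.
apply/mem_orthovP/andP => [wP|[/eqP wu /eqP wv] z /(mem_plane _ uv)[a [b ->]]].
  by rewrite !wP.
by rewrite [LHS]dotDr !dotZr wu wv !mulr0 addr0.
Qed.

Lemma mem_field_perp (V : E -> E) u w :
  (w \in field_perp V u) = (dot w u == 0) && (dot w (V u) == 0).
Proof. by rewrite memv_cap !mem_orthov1. Qed.

(** Both conditions in the definition of a graph are invariant under a change of
    positive basis, so they need only be tested on one basis of each plane. *)
Lemma is_graph_frame P Q (L : HomPerp P) (u v : subvs_of (plane P)) y w :
  positive_basis P (vsval u, vsval v) -> positive_basis Q (y, w) ->
  same_orientation (y, w) (vsval u + vsval (L u), vsval v + vsval (L v)) ->
  is_graph L Q.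
Proof.
move=> uvP ywQ yw.
have uvQ : positive_basis Q (vsval u + vsval (L u), vsval v + vsval (L v)).
  exact/(positive_basisE _ ywQ).
have graphD a b : a *: (vsval u + vsval (L u)) + b *: (vsval v + vsval (L v)) =
    vsval (a *: u + b *: v) + vsval (L (a *: u + b *: v)).
  have -> : L (a *: u + b *: v) = a *: L u + b *: L v by rewrite linearP linearZ.
  by rewrite !scalerDr addrACA !vsval_comb.
split=> [z|u' v'].
  rewrite (mem_plane _ uvQ); split=> [[a [b ->]]|[t ->]].
    by exists (a *: u + b *: v); rewrite graphD.
  have /(mem_plane _ uvP)[a [b tE]] := subvsP t.
  exists a, b; rewrite graphD (_ : t = a *: u + b *: v)//.
  by apply: val_inj; rewrite /= tE -vsval_comb.
move=> /(positive_basisE _ uvP)/same_orientationP[a [b [c [d [dp [u'E v'E]]]]]].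
have {}u'E : u' = a *: u + b *: v by apply: val_inj; rewrite /= u'E -vsval_comb.
have {}v'E : v' = c *: u + d *: v by apply: val_inj; rewrite /= v'E -vsval_comb.
apply/(positive_basisE _ uvQ)/same_orientationP; exists a, b, c, d; split=> //=.
by rewrite !graphD u'E v'E.
Qed.

Section FrameHom.
Variables (P : oriented_plane R m) (u v : E).

(** For [u], [v] an orthonormal basis of [P] and [B], [C] orthogonal to [P], the
    linear map sending [u] to [B] and [v] to [C]. *)
Definition frame_hom (B C : E) : HomPerp P :=
  linfun (fun z : subvs_of (plane P) =>
    vsproj (orthogonal_complement (plane P)) (dot (vsval z) u *: B + dot (vsval z) v *: C)).

Lemma frame_homE B C z :
  B \in orthogonal_complement (plane P) -> C \in orthogonal_complement (plane P) ->
  vsval (frame_hom B C z) = dot (vsval z) u *: B + dot (vsval z) v *: C.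
Proof.
move=> BP CP; pose f (z : subvs_of (plane P)) :=
  vsproj (orthogonal_complement (plane P)) (dot (vsval z) u *: B + dot (vsval z) v *: C).
have fl : linear f.
  move=> a z1 z2; rewrite /f -linearP; congr (vsproj _ _).
  by rewrite [vsval _]linearP !dotDl !dotZl; apply/rowP => i; rewrite !mxE; ring.
pose fL : {linear _ -> _} := HB.pack f (GRing.isLinear.Build _ _ _ _ _ fl).
rewrite /frame_hom (_ : linfun _ = linfun fL) // lfunE /= /f vsprojK//.
by rewrite memvD// memvZ.
Qed.

End FrameHom.
End OrientedPlanes.

(** * Fibrations by great circles *)

Section Fibration.
Context {R : realType} {n : nat} (F : great_circle_fibration R n).
Local Notation E := 'rV[R]_(2 * n + 2).
Local Notation V := (vfield F).
Implicit Types (x y B : E) (P Q : oriented_plane R (2 * n + 2)).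

Lemma vfield_unit y : unit_sphere y -> dot (V y) (V y) = 1.
Proof.
by move=> y1; have [P [[FP Py] _]] := fibres_partition F y1; case: (vfieldP FP Py).
Qed.

Section Fibre.
Variables (x : E) (P : oriented_plane R (2 * n + 2)).
Hypotheses (FP : base F P) (Px : great_circle P x).

Let x1 : dot x x = 1. Proof. by case: Px. Qed.
Let xV : dot x (V x) = 0. Proof. by case: (vfieldP FP Px). Qed.
Let Vx1 : dot (V x) (V x) = 1. Proof. by case: (vfieldP FP Px). Qed.
Let xVP : positive_basis P (x, V x). Proof. by case: (vfieldP FP Px). Qed.
Let xP : x \in plane P. Proof. by case: Px. Qed.
Let VxP : V x \in plane P. Proof. by case: (positive_basis_mem xVP). Qed.

Lemma fibre_coord u : u \in plane P -> u = dot u x *: x + dot u (V x) *: V x.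
Proof.
move/(mem_plane _ xVP) => [a [b ->]].
by rewrite !dotDl !dotZl x1 xV (dotC (V x)) xV Vx1 !mulr0 !mulr1 addr0 add0r.
Qed.

Lemma mem_complement u :
  (u \in orthogonal_complement (plane P)) = (dot u x == 0) && (dot u (V x) == 0).
Proof. exact: mem_orthogonal_complement. Qed.

Lemma field_perpE : field_perp V x = orthogonal_complement (plane P).
Proof. by apply/vspaceP => u; rewrite mem_field_perp mem_complement. Qed.

Definition perp_part (u : E) : E := u - dot u x *: x - dot u (V x) *: V x.

Lemma perp_partP u : perp_part u \in orthogonal_complement (plane P).
Proof.
rewrite mem_complement /perp_part -!scaleNr !dotDl !dotZl.
rewrite x1 xV (dotC (V x)) xV Vx1.
by apply/andP; split; apply/eqP; ring.
Qed.

Lemma covariant_derivativeE B :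
  covariant_derivative V x B = perp_part ('D_B (radial_extension V) x).
Proof.
have := covariant_derivative_perp B (vfield_smooth F) vfield_unit x1 xV.
rewrite mem_field_perp /covariant_derivative => /andP[_ /eqP].
rewrite -scaleNr dotDl dotZl xV mulr0 addr0 /perp_part => ->.
by rewrite scale0r subr0 scaleNr.
Qed.

Lemma is_derive_perp_part (w : R -> E) (t : R) (dw : E) :
  is_derive t 1 w dw -> is_derive t 1 (perp_part \o w) (perp_part dw).
Proof.
move=> wd; have c0 (z : E) := is_derive_cst z t (1 : R).
have dd z := is_derive_dot wd (c0 z).
have ss z := is_derive_scale (dd z) (c0 z).
apply: is_derive_eq (is_deriveB (is_deriveB wd (ss x)) (ss (V x))) _.
by rewrite !dotr0 !scaler0 !addr0.
Qed.

(** The velocity of a curve of the base: the fibres along the curve are the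
    graphs of [L t], and the field at the direction of [x + L t x] lies in the
    graph of [L t]. *)
Lemma tangent_covariant_derivative (L' : HomPerp P) :
  tangent_space (base F) P L' ->
  covariant_derivative V x (vsval (L' (vsproj (plane P) x))) =
  vsval (L' (vsproj (plane P) (V x))).
Proof.
move=> [L [e [e0 L0 sL LG LD]]].
set xp := vsproj (plane P) x; set vp := vsproj (plane P) (V x).
have xpE : vsval xp = x by exact: vsprojK.
have vpE : vsval vp = V x by exact: vsprojK.
have zero_e : (0 : R) \in `]-e, e[ by rewrite in_itv /= oppr_lt0 e0.
have dL z : is_derive (0 : R) 1 (fun t => vsval (L t z)) (vsval (L' z)).
  split; last by rewrite -derive1E.
  by apply: diff_derivable; have [+ _] := sL z 1%N; exact.
have L0z z : vsval (L 0 z) = 0 by rewrite L0 zero_lfunE.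
pose w t := radial_extension V (x + vsval (L t xp)).
have dw : is_derive (0 : R) 1 w ('D_(vsval (L' xp)) (radial_extension V) x).
  have dc : is_derive (0 : R) 1 (fun t => x + vsval (L t xp)) (vsval (L' xp)).
    apply: is_derive_eq (is_deriveD (is_derive_cst x (0 : R) 1) (dL xp)) _.
    by rewrite add0r.
  have [U [oU Ux sU _]] := smooth_radial_extension (vfield_smooth F) (x1 : unit_sphere x).
  have := @is_derive_comp_row _ _ _ (radial_extension V) _ _ _ dc.
  by rewrite L0z addr0; apply; have [+ _] := sU 1%N; exact.
have w0 : w 0 = V x by rewrite /w L0z addr0 radial_extension_id.
have perp t z : dot (vsval (L t z)) x = 0 /\ dot (vsval (L t z)) (V x) = 0.
  by have := subvsP (L t z); rewrite mem_complement => /andP[/eqP -> /eqP ->].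
have wE : \forall t \near (0 : R), dot (w t) x *: vsval (L t xp) +
    dot (w t) (V x) *: vsval (L t vp) = (perp_part \o w) t.
  have : \forall t \near (0 : R), t \in `]-e, e[ by exact: near_in_itvoo.
  apply: filterS => t /LG[Q FQ [QG _]].
  pose y := x + vsval (L t xp).
  have Qy : y \in plane Q by apply/QG; exists xp; rewrite xpE.
  have y0 : 0 < dot y y.
    apply: dot_gt0; apply: contra_eq_neq x1 => y0.
    rewrite (_ : dot x x = dot y x); last by rewrite dotDl (perp _ _).1 addr0.
    by rewrite y0 dotC dotr0 eq_sym oner_eq0.
  have Ny : great_circle Q (normalize y).
    by split; [exact: unit_normalize|rewrite memvZ].
  have wQ : w t \in plane Q.
    by have [_ _ /positive_basis_mem[]] := vfieldP FQ Ny.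
  have [u wu] := (QG (w t)).1 wQ.
  have ux : dot (w t) x = dot (vsval u) x by rewrite wu dotDl (perp _ _).1 addr0.
  have uV : dot (w t) (V x) = dot (vsval u) (V x) by rewrite wu dotDl (perp _ _).2 addr0.
  have uE := fibre_coord (subvsP u); rewrite -ux -uV in uE.
  have {}uE' : u = dot (w t) x *: xp + dot (w t) (V x) *: vp.
    by apply: val_inj; rewrite [RHS]vsval_comb xpE vpE; exact: uE.
  have -> : dot (w t) x *: vsval (L t xp) + dot (w t) (V x) *: vsval (L t vp) =
      vsval (L t u) by rewrite uE' linearP linearZ vsval_comb.
  rewrite /= /perp_part {1}wu uE.
  by apply/rowP => i; rewrite !mxE; ring.
rewrite covariant_derivativeE.
have c0 (z : E) := is_derive_cst z (0 : R) (1 : R).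
have dl := is_deriveD (is_derive_scale (is_derive_dot dw (c0 x)) (dL xp))
  (is_derive_scale (is_derive_dot dw (c0 (V x))) (dL vp)).
have [_ <-] := is_derive_perp_part dw.
rewrite -(near_eq_derive _ wE); have [_ ->] := dl.
by rewrite !L0z w0 !scaler0 !add0r (dotC (V x)) xV Vx1 scale0r scale1r add0r.
Qed.

Section Curve.
Variable B : E.
Hypothesis BP : B \in orthogonal_complement (plane P).

(** [w t] is the field at the direction of [x + t B]; [C t] is the value at [V x]
   that makes [w t] belong to the graph of a map sending [x] to [t B]. *)
Let w (t : R) : E := radial_extension V (x + t *: B).
Let C (t : R) : E :=
  (dot (w t) (V x))^-1 *: (perp_part (w t) - (dot (w t) x * t) *: B).

Let CP t : C t \in orthogonal_complement (plane P).
Proof. by rewrite memvZ// memvB ?memvZ// perp_partP. Qed.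

Let dw : is_derive (0 : R) 1 w ('D_B (radial_extension V) x).
Proof.
have dc : is_derive (0 : R) 1 (fun t => x + t *: B) B.
  have dt := is_derive_scale (is_derive_id (0 : R) 1) (is_derive_cst B (0 : R) 1).
  apply: is_derive_eq (is_deriveD (is_derive_cst x (0 : R) 1) dt) _.
  by rewrite add0r scale1r scaler0 addr0.
have [U [oU Ux sU _]] := smooth_radial_extension (vfield_smooth F) (x1 : unit_sphere x).
have := @is_derive_comp_row _ _ _ (radial_extension V) _ _ _ dc.
by rewrite scale0r addr0; apply; have [+ _] := sU 1%N; exact.
Qed.

Let w0 : w 0 = V x.
Proof. by rewrite /w scale0r addr0 radial_extension_id. Qed.

Let perp_part_Vx : perp_part (V x) = 0.
Proof. by rewrite /perp_part (dotC (V x) x) xV Vx1 scale0r scale1r subr0 subrr. Qed.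

Let C0 : C 0 = 0.
Proof. by rewrite /C w0 perp_part_Vx mulr0 scale0r subr0 scaler0. Qed.

Let dC : is_derive (0 : R) 1 C (covariant_derivative V x B).
Proof.
have c0 (z : E) := is_derive_cst z (0 : R) (1 : R).
have da := is_derive_dot dw (c0 x); have db := is_derive_dot dw (c0 (V x)).
have wV0 : dot (w 0) (V x) != 0 by rewrite w0 Vx1 oner_eq0.
have dbV := is_deriveV wV0 db.
have dtB := is_derive_scale (is_deriveM da (is_derive_id (0 : R) 1)) (c0 B).
apply: is_derive_eq (is_derive_scale dbV (is_deriveB (is_derive_perp_part dw) dtB)) _.
rewrite covariant_derivativeE !fctE /= w0 perp_part_Vx (dotC (V x) x) xV Vx1.
rewrite !scale0r !scaler0 !mulr0 !scale0r.
by rewrite subrr scaler0 invr1 scale1r !addr0 scale0r subr0 add0r.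
Qed.

(** The fibres through the directions of [x + t B] are graphs over [P] as long as
    the field there has a positive component along [V x], which by continuity
    holds for small [t]. *)
Lemma exists_tangent : exists2 L : HomPerp P,
  tangent_space (base F) P L & vsval (L (vsproj (plane P) x)) = B.
Proof.
have DP : covariant_derivative V x B \in orthogonal_complement (plane P).
  by rewrite covariant_derivativeE perp_partP.
exists (frame_hom P x (V x) B (covariant_derivative V x B)); last first.
  by rewrite frame_homE// vsprojK// x1 xV scale1r scale0r addr0.
pose L t := frame_hom P x (V x) (t *: B) (C t).
have LE t z : vsval (L t z) = dot (vsval z) x *: (t *: B) + dot (vsval z) (V x) *: C t.
  by rewrite frame_homE// memvZ.
have [U [oU Ux sU Upos]] := smooth_radial_extension (vfield_smooth F) (x1 : unit_sphere x).
pose c (t : R) := x + t *: B.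
have sc : smooth_open [set: R] c.
  move=> k; apply: is_CkD; [exact: openT|exact: is_Ck_cst|].
  by apply: is_CkZ; [exact: openT|exact: is_Ck_id|exact: is_Ck_cst].
pose T := c @^-1` U.
have oT : open T.
  by apply: open_comp => // t _; exact: (sc 0%N).
have sw : smooth_open T w.
  move=> k; apply/is_Ck_row => // j.
  apply: (@is_Ck_comp _ _ _ _ _ U (fun y => radial_extension V y 0 j) c) => //.
    by have /(is_Ck_row _ _ oU)/(_ j) := sU k.
  exact: is_Ck_sub (sc k).
have sb : smooth_open T (fun t => dot (w t) (V x)).
  by move=> k; apply: is_Ck_dot => //; exact: is_Ck_cst.
(* Where this holds, the plane of the fibre projects onto [P] preserving orientation. *)
pose S := T `&` [set t | 0 < dot (w t) (V x)].
have oS : open S.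
  rewrite openE => t [Tt bt]; apply: filterI; first exact: open_nbhs_nbhs.
  apply: (sb 0%N t Tt [set r | 0 < r]); exact: lt_nbhsr.
have S0 : S 0.
  by split; rewrite /T /= ?w0 ?Vx1// /c scale0r addr0.
have [e e0 eS] : exists2 e : R, 0 < e & forall t, t \in `]-e, e[ -> S t.
  have /nbhs_ballP[e /= e0 eS] := open_nbhs_nbhs (conj oS S0).
  exists e => // t; rewrite in_itv /= => te; apply: eS.
  by rewrite /ball /= sub0r normrN ltr_norml.
have sC : smooth_open `]-e, e[%classic C.
  move=> k; have oe : open `]-e, e[%classic by exact: interval_open.
  have eT : `]-e, e[%classic `<=` T by move=> t /eS[].
  have swe := is_Ck_sub eT (sw k).
  have dk z : is_Ck k `]-e, e[%classic (fun t => dot (w t) z).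
    by apply: is_Ck_dot => //; exact: is_Ck_cst.
  have nk (a : R -> R) (z : E) : is_Ck k `]-e, e[%classic a ->
      is_Ck k `]-e, e[%classic (fun t => (- 1 * a t) *: z).
    move=> ak; apply: is_CkZ => //; last exact: is_Ck_cst.
    by apply: is_CkM => //; exact: is_Ck_cst.
  (* Differences are written with a factor -1, so that sums and products suffice. *)
  have -> : C = fun t => (dot (w t) (V x))^-1 *: (w t + (- 1 * dot (w t) x) *: x +
      (- 1 * dot (w t) (V x)) *: V x + (- 1 * (dot (w t) x * t)) *: B).
    by apply/funext => t; rewrite /C /perp_part !mulN1r !scaleNr.
  apply: is_CkZ => //.
    apply: (@smooth_inv _ _ _ (fun t => dot (w t) (V x))) => // [t /eS[_ bt]|k'].
      by rewrite gt_eqF.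
    exact: is_Ck_sub eT (sb k').
  apply: is_CkD => //; last first.
    by apply: nk; apply: is_CkM => //; exact: is_Ck_id.
  apply: is_CkD => //; last exact: nk.
  apply: is_CkD => //; exact: nk.
have LE' z : (fun t => vsval (L t z)) =
    fun t => dot (vsval z) x *: (t *: B) + dot (vsval z) (V x) *: C t.
  by apply/funext => t; exact: LE.
exists L, e; split=> //.
- apply/lfunP => z; apply: val_inj; rewrite [LHS]LE C0 scale0r !scaler0 addr0.
  by rewrite zero_lfunE.
- move=> z k; rewrite LE'.
  have oe : open `]-e, e[%classic by exact: interval_open.
  apply: is_CkD => //; apply: is_CkZ oe (is_Ck_cst _ _ _) _.
    by apply: is_CkZ => //; [exact: is_Ck_id|exact: is_Ck_cst].
  exact: sC.
- move=> t /eS[Tt /= bt].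
  have N1 : unit_sphere (normalize (c t)) by apply/unit_normalize/Upos.
  have [Q [[FQ Qy] _]] := fibres_partition F N1.
  exists Q => //; have [_ _ QV] := vfieldP FQ Qy.
  apply: (@is_graph_frame _ _ _ _ _ (vsproj (plane P) x) (vsproj (plane P) (V x)) _ _ _ QV).
    by rewrite !vsprojK.
  have i0 : 0 < inv_norm (c t) by rewrite invr_gt0 sqrtr_gt0; exact: Upos.
  (* With c = x + t B, one has x + L x = c = |c| (c / |c|) and
     V x + L (V x) = b^-1 (w - a c): a triangular change of basis. *)
  apply/same_orientationP => /=; rewrite -[V (normalize (c t))]/(w t).
  exists (inv_norm (c t))^-1, 0, (- (dot (w t) (V x))^-1 * dot (w t) x / inv_norm (c t)),
    (dot (w t) (V x))^-1; split.
    by rewrite mul0r subr0 mulr_gt0 // invr_gt0.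
  rewrite !LE !vsprojK// x1 xV (dotC (V x) x) xV Vx1; congr pair.
    by rewrite !scale1r !scale0r !addr0 scalerA mulVf ?gt_eqF// scale1r.
  rewrite scale0r scale1r add0r scalerA divfK ?gt_eqF// /C /perp_part /c.
  have bt0 : dot (w t) (V x) != 0 by rewrite gt_eqF.
  by apply/rowP => i; rewrite !mxE; field.
- move=> z; rewrite derive1E frame_homE//; apply: derive_val.
  rewrite LE'.
  have dtB : is_derive (0 : R) 1 (fun t : R => t *: B) B.
    have dt := is_derive_scale (is_derive_id (0 : R) 1) (is_derive_cst B (0 : R) 1).
    by apply: is_derive_eq dt _; rewrite scale1r scaler0 addr0.
  have dz a := is_derive_cst (dot (vsval z) a) (0 : R) (1 : R).
  apply: is_derive_eq (is_deriveD (is_derive_scale (dz x) dtB)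
    (is_derive_scale (dz (V x)) dC)) _.
  by rewrite !scale0r !add0r.
Qed.

End Curve.

End Fibre.

Lemma twisting_covariant x (B : subvs_of (field_perp V x)) : unit_sphere x ->
  vsval (twisting V x B) = covariant_derivative V x (vsval B).
Proof.
move=> x1; have [P [[FP Px] _]] := fibres_partition F x1.
have [_ xV _] := vfieldP FP Px.
exact: twistingE (vfield_smooth F) vfield_unit x1 xV.
Qed.

(** A tangent map L with L x = B and L (V x) = a B kills V x - a x.  Comparing at the
    point of the fibre in that direction, where the covariant derivative along
    0 vanishes, shows that L is zero on the whole plane. *)
Lemma covariant_derivative_eigen x P B (a : R) : base F P -> great_circle P x ->
  B \in orthogonal_complement (plane P) ->
  covariant_derivative V x B = a *: B -> B = 0.
Proof.
move=> FP Px BP; have [x1 xP] := Px; have [Vx1 xV xVP] := vfieldP FP Px.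
have [_ VxP] := positive_basis_mem xVP.
move=> eigB; set y := V x - a *: x.
have yP : y \in plane P by rewrite memvB// memvZ.
have y0 : 0 < dot y y.
  apply: dot_gt0; apply: contra_eq_neq Vx1 => y0.
  rewrite (_ : dot (V x) (V x) = dot y (V x)); last first.
    by rewrite /y -scaleNr dotDl dotZl xV mulr0 addr0.
  by rewrite y0 dotC dotr0 eq_sym oner_eq0.
pose z := normalize y.
have Pz : great_circle P z by split; [exact: unit_normalize|rewrite memvZ].
have [_ zP] := Pz; have [_ _ zVP] := vfieldP FP Pz.
have [_ VzP] := positive_basis_mem zVP.
have [L LT LB] := exists_tangent FP Px BP.
pose f u := vsval (L (vsproj (plane P) u)).
have f_comb b c u v : f (b *: u + c *: v) = b *: f u + c *: f v.
  by rewrite /f linearP linearZ linearP linearZ vsval_comb.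
have fV : f (V x) = a *: B.
  by rewrite /f -(tangent_covariant_derivative FP Px LT) LB eigB.
have fy : f y = 0.
  rewrite (_ : y = 1 *: V x + (- a) *: x); last by rewrite scale1r scaleNr.
  by rewrite f_comb fV /f LB scale1r scaleNr subrr.
have fz : f z = 0.
  rewrite (_ : z = inv_norm y *: y + 0 *: y); last by rewrite scale0r addr0.
  by rewrite f_comb fy !scaler0 addr0.
have fVz : f (V z) = 0.
  rewrite /f -(tangent_covariant_derivative FP Pz LT) -/(f z) fz.
  by rewrite /covariant_derivative derive0 (dotC 0) dotr0 scale0r subr0.
have -> : B = f x by [].
by rewrite (fibre_coord FP Pz xP) f_comb fz fVz !scaler0 addr0.
Qed.

End Fibration.

Theorem proposition1 (R : realType) (n : nat) (hn : (1 <= n)%N)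
    (F : great_circle_fibration R n) (x : 'rV[R]_(2 * n + 2))
    (hx : unit_sphere x) (P : oriented_plane R (2 * n + 2))
    (hP : base F P) (hxP : great_circle P x) :
  [set (vsval B, vsval (twisting (vfield F) x B)) | B in
     [set: subvs_of (field_perp (vfield F) x)]] =
  [set (vsval (L (vsproj (plane P) x)), vsval (L (vsproj (plane P) (vfield F x))))
     | L in tangent_space (base F) P]
  /\ (forall a : R, ~~ passmx.leigenvalue (twisting (vfield F) x) a).
Proof.
have perpE u : (u \in field_perp (vfield F) x) =
    (u \in orthogonal_complement (plane P)) by rewrite (field_perpE hP hxP).
split.
  apply/seteqP; split=> [_ [B _ <-]|_ [L LT <-]] /=.
    have BP := subvsP B; rewrite perpE in BP.
    have [L LT LB] := exists_tangent hP hxP BP; exists L => //.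
    by rewrite -(tangent_covariant_derivative hP hxP LT) LB twisting_covariant.
  have Lperp := subvsP (L (vsproj (plane P) x)); rewrite -perpE in Lperp.
  exists (vsproj _ (vsval (L (vsproj (plane P) x)))) => //.
  rewrite twisting_covariant// vsprojK//.
  by rewrite (tangent_covariant_derivative hP hxP LT).
move=> a; apply/negPn => /=; rewrite -subv0; apply/subvP => B.
rewrite memv_ker add_lfunE opp_lfunE scale_lfunE id_lfunE subr_eq0 => /eqP eigB.
rewrite memv0; apply/eqP/val_inj; have BP := subvsP B; rewrite perpE in BP.
apply: (covariant_derivative_eigen hP hxP BP (a := a)).
by rewrite -twisting_covariant// eigB linearZ.
Qed.
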